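(* There is an absolute constant $C>0$ such that the following holds. Let $p$ be an odd prime and let $P$ be a finite $p$-group of nilpotency class at most $2$ (i.e. $[P,P]\le Z(P)$) and exponent $p$, with $|P/Z(P)|=p^n$. Then the number of maximal abelian subgroups of $P$ is at most $p^{\frac{1}{6}n^2+Cn}$.
   Context: $Z(P)$ denotes the center and $[P,P]$ the commutator subgroup of $P$. A maximal abelian subgroup is an abelian subgroup not properly contained in any other abelian subgroup. *)

(* Defs.v *)
From mathcomp Require Import all_boot all_fingroup all_solvable.
From Stdlib Require Import Reals.
Set Implicit Arguments. Unset Strict Implicit. Unset Printing Implicit Defensive.

Definition max_abelian_subgroups (gT : finGroupType) (P : {group gT}) :
  {set {group gT}} :=
  [set A : {group gT} | maxgroup A (fun B : {group gT} => (B \subset P) && abelian B)].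

(* Main.v *)
(* Draw u_1, u_2, ... one after the other, each uniformly from the centraliser in
   P of the previous ones. If |A : Z(P)| = p ^ k, a maximal abelian subgroup A is
   generated modulo Z(P) by each of its k-element bases, so the total probability
   of the bases of A, summed over all A of this index, is at most 1. An element v
   outside A is centralised by a proper subgroup of A only, hence by at most a
   proportion p ^ -i of the i-element independent sequences of A; so the mean of
   |C_P(u_1, ..., u_i)| over these is at most |A| + |P| / p ^ i, and AM-GM bounds
   the probability of the bases of A below by p ^ -(sum_(i < k) (2 + (n - k - i)^+)).
   The truncated sum of the n - k - i is at most n ^ 2 / 6 + n / 2, the extremal
   case being k = n / 3. *)
Require Import Defs.
From Stdlib Require Import Reals Lra.
From mathcomp Require Import all_boot all_fingroup all_solvable.
From mathcomp Require Import all_order all_algebra zify.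
Set Implicit Arguments. Unset Strict Implicit. Unset Printing Implicit Defensive.
Import Order.TTheory GRing.Theory Num.Theory.
Local Open Scope nat_scope.

(** * Sums and products over tuples, one entry at a time *)

Lemma big_tuple_cons (R : Type) (idx : R) (op : Monoid.com_law idx)
    (T : finType) (k : nat) (P Q : pred (seq T)) (S : seq T -> pred T)
    (F : seq T -> R) :
    (forall u s, P (u :: s) = Q s && S s u) ->
  \big[op/idx]_(t : k.+1.-tuple T | P t) F t =
  \big[op/idx]_(s : k.-tuple T | Q s) \big[op/idx]_(u | S s u) F (u :: s).
Proof.
move=> PE; rewrite pair_big_dep /=.
rewrite (reindex (fun x : k.-tuple T * T => [tuple of x.2 :: x.1])) /=.
  by apply: eq_bigl => -[s u] /=; rewrite PE.
exists (fun t : k.+1.-tuple T => ([tuple of behead t], thead t)).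
  by case=> s u _; congr pair; apply: val_inj.
by move=> t _; rewrite [RHS]tuple_eta.
Qed.

Lemma big_tuple0 (R : Type) (idx : R) (op : Monoid.com_law idx)
    (T : finType) (P : pred (seq T)) (F : seq T -> R) :
  P [::] -> \big[op/idx]_(t : 0.-tuple T | P t) F t = F [::].
Proof.
by move=> P0; rewrite (big_pred1 [tuple]) // => t; rewrite (tuple0 t) /= P0 eqxx.
Qed.

(** * AM-GM estimates and the sum in the exponent *)

Lemma prod_le_exp_mean (I : finType) (A : {pred I}) (E : I -> nat) (a : nat) :
  \sum_(i in A) E i <= #|A| * a -> \prod_(i in A) E i <= a ^ #|A|.
Proof.
move=> sumE; have [/eqP A0|A_gt0] := posnP #|A|.
  by rewrite (eqP A0) big_pred0 //; apply/card0_eq/eqP.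
have [+ _] := @leif_AGM rat I A (fun i => (E i)%:R%R) (fun i _ => ler0n _ _).
rewrite -natr_prod -natr_sum -(ler_nat rat) natrX => /le_trans -> //.
rewrite lerXn2r ?nnegrE ?divr_ge0 ?ler0n // ler_pdivrMr ?ltr0n //.
by rewrite -natrM ler_nat mulnC.
Qed.

(** AM-GM for the inverses: their mean is at least the inverse of the geometric mean of [E], hence
    at least [1 / a]. *)
Lemma sum_inv_ge_of_prod_le (I : finType) (A : {pred I}) (E : I -> nat) (a : nat) :
    0 < a -> {in A, forall i, 0 < E i} -> \prod_(i in A) E i <= a ^ #|A| ->
  (#|A|%:R / a%:R <= \sum_(i in A) (E i)%:R^-1 :> rat)%R.
Proof.
move=> a_gt0 E_gt0 prodE.
have inv_ge0 i : (0 <= (E i)%:R^-1 :> rat)%R by rewrite invr_ge0 ler0n.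
have [A0|A_gt0] := posnP #|A|; first by rewrite A0 mul0r sumr_ge0.
have [+ _] := @leif_AGM rat I A (fun i => (E i)%:R^-1%R) (fun i _ => inv_ge0 i).
rewrite prodfV -natr_prod => AGM.
have : (a%:R^-1 ^+ #|A| <=
    ((\sum_(i in A) (E i)%:R^-1) / #|A|%:R) ^+ #|A| :> rat)%R.
  apply: le_trans AGM.
  rewrite exprVn lef_pV2 ?posrE ?exprn_gt0 ?ltr0n ?prodn_cond_gt0 //.
  by rewrite -natrX ler_nat.
rewrite ler_pXn2r ?nnegrE ?invr_ge0 ?divr_ge0 ?sumr_ge0 ?ler0n //.
by rewrite ler_pdivlMr ?ltr0n // mulrC.
Qed.

Lemma sum_sub_le (m k : nat) :
  6 * \sum_(i < k) (m - i) <= (m + k) ^ 2 + 3 * (m + k).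
Proof.
have sumE : 2 * \sum_(i < k) (m - i) + (m - k) * (m - k).+1 = m * m.+1.
  elim: k => [|k IHk]; first by rewrite big_ord0 subn0.
  rewrite big_ord_recr mulnDr -addnA -IHk /=; congr (_ + _).
  by case: (m - k) (subnS m k) => [|d] ->; lia.
move: (\sum_(i < k) _) sumE => S; rewrite -mulnn.
(* For [m <= k] the terms beyond [m] vanish and [2 * S = m * (m + 1)]. *)
have [km|/ltnW mk] := leqP k m; last first.
  have := leq_mul mk (leqnn m); have := leq_mul (leqnn k) mk.
  by rewrite (eqP mk); lia.
rewrite -(subnK km) addnK; move: (m - k) => d.
(* With [m = d + k] the quadratic terms reduce to [2 * d * k <= d ^ 2 + k ^ 2], which is tight at
   [d = k], that is [m = 2 * k]. *)
by have [+ _] := nat_Cauchy d k; rewrite -!mulnn; lia.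
Qed.

(** * Sequences independent modulo a subgroup, and their number *)

Section IndependentSequences.
Variables (gT : finGroupType) (Z : {group gT}).
Local Open Scope group_scope.

(* The last element drawn stands at the head of the sequence. *)
Fixpoint indep_mod (s : seq gT) : bool :=
  if s is u :: s' then (u \notin Z <*> [set:: s']) && indep_mod s' else true.

Definition indep_in (H : {group gT}) (s : seq gT) :=
  all (mem H) s && indep_mod s.

Lemma indep_in_cons (H : {group gT}) (u : gT) (s : seq gT) :
  indep_in H (u :: s) = indep_in H s && (u \in H :\: (Z <*> [set:: s])).
Proof. by rewrite /indep_in /= inE; do !case: (_ \in _); case: all; case: indep_mod. Qed.

Lemma sub_joing_indep (H : {group gT}) (s : seq gT) :
  Z \subset H -> all (mem H) s -> Z <*> [set:: s] \subset H.
Proof.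
by move=> sZH /allP sH; rewrite join_subG sZH; apply/subsetP=> u; rewrite inE => /sH.
Qed.

Lemma joing_cons (B : {set gT}) (u : gT) (s : seq gT) :
  B <*> [set:: u :: s] = (B <*> [set:: s]) <*> <[u]>.
Proof. by rewrite joing_idr joing_idl set_cons /joing [u |: _]setUC setUA. Qed.

Section Abelian.
Variables (p : nat) (A : {group gT}).
Hypotheses (p_pr : prime p) (cAA : abelian A) (expA : exponent A %| p)
  (sZA : Z \subset A).

(** Each new element has order [p] and lies outside the subgroup generated so far, so its cycle
    meets that subgroup trivially and multiplies the order by [p]. *)
Lemma card_joing_indep (s : seq gT) :
  indep_in A s -> #|Z <*> [set:: s]| = (#|Z| * p ^ size s)%N.
Proof.
elim: s => [|u s IHs].
  by rewrite set_nil /joing setU0 genGid muln1.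
rewrite indep_in_cons inE => /andP[/[dup] /andP[sA _] /IHs {}IHs /andP[uNs uA]].
have ou : #[u] = p.
  have u_neq1 : #[u] != 1%N.
    by rewrite order_eq1; apply: contraNneq uNs => ->; apply: group1.
  by apply/(prime_nt_dvdP p_pr u_neq1)/(dvdn_trans (dvdn_exponent uA) expA).
have sBA := sub_joing_indep sZA sA.
rewrite joing_cons cent_joinEr; last first.
  by rewrite (subset_trans _ (centS sBA)) // (subset_trans _ cAA) // cycle_subG.
rewrite TI_cardMg ?IHs -?orderE ?ou /= ?expnSr ?mulnA // setIC.
by rewrite prime_TIg -?orderE ?ou // cycle_subG.
Qed.

Lemma card_indep_ext (H : {group gT}) (s : seq gT) :
    Z \subset H -> H \subset A -> indep_in H s ->
  #|H :\: (Z <*> [set:: s])| = #|H| - #|Z| * p ^ size s.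
Proof.
move=> sZH sHA /andP[sH fs]; rewrite cardsD (setIidPr _) ?sub_joing_indep //.
rewrite card_joing_indep // /indep_in fs andbT.
by apply: sub_all sH => u; apply: (subsetP sHA).
Qed.

(** The count depends on [H] only through its order, which allows a comparison of [A] with its
    subgroups ['C_A[v]]. Truncated subtraction gives a zero factor once a prefix already fills
    [H]. *)
Lemma card_indep (H : {group gT}) (k : nat) :
    Z \subset H -> H \subset A ->
  #|[set t : k.-tuple gT | indep_in H t]| =
    (\prod_(j < k) (#|H| - #|Z| * p ^ j))%N.
Proof.
move=> sZH sHA; rewrite -sum1dep_card; elim: k => [|k IHk].
  by rewrite (@big_tuple0 _ _ _ _ (indep_in H) (fun _ => 1%N)) // big_ord0.
rewrite (@big_tuple_cons _ _ _ _ _ (indep_in H) _ _ (fun _ => 1%N)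
  (indep_in_cons H)) big_ord_recr /= -IHk big_distrl /=.
apply: eq_bigr => t ft; rewrite sum1_card mul1n -[X in (p ^ X)%N](size_tuple t).
by rewrite -card_indep_ext //; apply: eq_card => u; rewrite !inE.
Qed.

(** Double counting of the pairs of a sequence [s] and an element [v] of [P] centralising it. For
    [v] in [A] every [s] occurs, which gives the term in [#|A|]; for [v] outside [A] only the
    sequences inside ['C_A[v]] occur, which gives the term in [#|P|]. *)
Lemma sum_centraliser_indep (P : {group gT}) (i : nat) :
    A \subset P -> Z \subset 'Z(P) ->
    (forall v, v \in P :\: A -> p * #|'C_A[v]| <= #|A|)%N ->
  ((\sum_(s : i.-tuple gT | indep_in A s) #|'C_P([set:: s])|) * p ^ i <=
   #|[set s : i.-tuple gT | indep_in A s]| * (#|A| * p ^ i + #|P|))%N.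
Proof.
move=> sAP sZZP ltCA; have [sZP cZP] := subsetIP sZZP.
pose N (H : {group gT}) := #|[set s : i.-tuple gT | indep_in H s]|.
have sumE : (\sum_(s : i.-tuple gT | indep_in A s) #|'C_P([set:: s])| =
    \sum_(v in P) N 'C_A[v]%G)%N.
  under [LHS]eq_bigr => s _ do rewrite -sum1_card.
  rewrite (exchange_big_dep (mem P)) /=; last by move=> s v _ /setIP[].
  apply: eq_bigr => v vP; rewrite sum1dep_card; apply: eq_card => s.
  rewrite !inE vP /= /indep_in andbAC; congr (_ && _).
  apply/andP/allP => [[/allP sA /centP cs] u us|sCA].
    apply/setIP; split; first exact: sA.
    by apply/cent1P/commute_sym/cs; rewrite inE.
  split; first by apply/allP => u /sCA /setIP[].
  by apply/centP => u; rewrite inE => /sCA /setIP[_ /cent1P].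
rewrite sumE (bigID (mem A)) /= mulnDl mulnDr leq_add //.
  rewrite mulnA leq_mul2r orbC -/(N A) mulnC -sum_nat_const.
  rewrite [X in (_ <= X)%N](eq_bigl (fun v => (v \in P) && (v \in A))); last first.
    by move=> v; rewrite andb_idl // => /(subsetP sAP).
  rewrite leq_sum // => v /andP[_ vA]; have -> // : 'C_A[v]%G = A.
  apply/val_inj/setIidPl/subsetP => u uA.
  exact/cent1P/(centsP cAA).
rewrite -/(N A) mulnC [(N A * _)%N]mulnC big_distrr -sum_nat_const /=.
rewrite [X in (_ <= X)%N](bigID (mem A)) /= -[X in (X <= _)%N]add0n leq_add //.
apply: leq_sum => v /andP[vP vNA].
have sZC : Z \subset 'C_A[v].
  by rewrite subsetI sZA sub_cent1 (subsetP _ _ vP) // centsC.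
rewrite /N !card_indep ?subsetIl // -{1}(card_ord i) -prod_nat_const -big_split /=.
(* Each of the [i] factors loses at least a factor [p] when [A] is replaced by ['C_A[v]]. *)
apply: leq_prod => j _; rewrite mulnBr leq_sub //; first by apply: ltCA; rewrite inE vNA.
by rewrite leq_pmull ?prime_gt0.
Qed.
End Abelian.
End IndependentSequences.

(** * The random commuting sequence and its probabilities *)

Section CentraliserWeights.
Variables (gT : finGroupType) (P : {group gT}).
Local Open Scope group_scope.

Fixpoint commuting_in (s : seq gT) : bool :=
  if s is u :: s' then commuting_in s' && (u \in 'C_P([set:: s'])) else true.

(* The inverse of this weight is the probability of obtaining [s] when each
   element is drawn uniformly from the centraliser of the previous ones. *)
Fixpoint cent_prod (s : seq gT) : nat :=
  if s is u :: s' then (cent_prod s' * #|'C_P([set:: s'])|)%N else 1%N.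

Lemma cent_prod_gt0 (s : seq gT) : (0 < cent_prod s)%N.
Proof. by elim: s => //= u s IHs; rewrite muln_gt0 IHs cardG_gt0. Qed.

(** Total probability: the [#|'C_P([set:: s])|] continuations of [s] share its weight equally. *)
Lemma sum_inv_cent_prod (k : nat) :
  (\sum_(s : k.-tuple gT | commuting_in s) (cent_prod s)%:R^-1 = 1 :> rat)%R.
Proof.
elim: k => [|k IHk].
  by rewrite (@big_tuple0 _ _ _ _ commuting_in
    (fun s => (cent_prod s)%:R^-1 : rat)%R) ?invr1.
rewrite (@big_tuple_cons _ _ _ _ _ commuting_in commuting_in
  (fun s u => u \in 'C_P([set:: s]))
  (fun s => (cent_prod s)%:R^-1 : rat)%R) // -[RHS]IHk.
apply: eq_bigr => s _ /=; rewrite sumr_const -[LHS]mulr_natr natrM invfM -mulrA.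
by rewrite mulVf ?mulr1 // pnatr_eq0 -lt0n cardG_gt0.
Qed.

Lemma indep_in_commuting (Z A : {group gT}) (s : seq gT) :
  abelian A -> A \subset P -> indep_in Z A s -> commuting_in s.
Proof.
move=> cAA sAP; elim: s => //= u s IHs; rewrite indep_in_cons => /andP[fs].
rewrite IHs //= !inE => /andP[_ uA]; rewrite (subsetP sAP) //=.
apply/centP => v; rewrite inE => vs; apply: (centsP cAA) => //.
by case/andP: fs => /allP/(_ v vs).
Qed.

(** Every independent prefix of length [k] has the same number of extensions in [A], so the product
    splits into the one for shorter sequences and a product of centraliser orders, to which AM-GM
    applies. *)
Lemma prod_cent_prod_le (p : nat) (Z A : {group gT}) (a : nat -> nat) (k : nat) :
    prime p -> abelian A -> exponent A %| p -> Z \subset A ->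
    (forall i, i < k ->
      \sum_(s : i.-tuple gT | indep_in Z A s) #|'C_P([set:: s])| <=
      #|[set s : i.-tuple gT | indep_in Z A s]| * a i)%N ->
  (\prod_(s : k.-tuple gT | indep_in Z A s) cent_prod s <=
   (\prod_(i < k) a i) ^ #|[set s : k.-tuple gT | indep_in Z A s]|)%N.
Proof.
move=> p_pr cAA expA sZA; elim: k => [|k IHk] mean_le.
  by rewrite (@big_tuple0 _ _ _ _ (indep_in Z A) cent_prod) // big_ord0 exp1n.
rewrite (@big_tuple_cons _ _ _ _ _ (indep_in Z A) _ _ cent_prod
  (indep_in_cons Z A)) /=.
have -> : #|[set s : k.+1.-tuple gT | indep_in Z A s]| =
    (#|[set s : k.-tuple gT | indep_in Z A s]| * (#|A| - #|Z| * p ^ k))%N.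
  by rewrite !(card_indep p_pr cAA) // big_ord_recr.
under eq_bigr => s fs.
  rewrite prod_nat_const.
  have -> : #|(fun u => u \in A :\: Z <*> [set:: s])| = (#|A| - #|Z| * p ^ k)%N.
    rewrite -[X in (p ^ X)%N](size_tuple s) -(card_indep_ext p_pr cAA) //.
  over.
rewrite -(big_morph (expn^~ _) (fun x y => expnMn x y _) (exp1n _)) /= expnM.
(* If no extension exists, both sides equal 1. *)
case: (_ - _)%N => // m; rewrite leq_exp2r // big_split /= big_ord_recr expnMn.
apply: leq_mul; first by apply: IHk => i lt_ik; apply/mean_le/ltnW.
rewrite -[X in (X <= _)%N]big_set; apply: prod_le_exp_mean.
by rewrite big_set; apply: mean_le.
Qed.

Lemma sum_inv_cent_prod_ge (p n k : nat) (Z A : {group gT}) :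
    prime p -> abelian A -> exponent A %| p -> Z \subset A ->
    A \subset P -> Z \subset 'Z(P) ->
    (forall v, v \in P :\: A -> p * #|'C_A[v]| <= #|A|)%N ->
    #|P| = (#|Z| * p ^ n)%N -> #|A| = (#|Z| * p ^ k)%N ->
  ((p ^ (\sum_(i < k) (2 + (n - k - i))))%:R^-1 <=
    \sum_(s : k.-tuple gT | indep_in Z A s) (cent_prod s)%:R^-1 :> rat)%R.
Proof.
move=> p_pr cAA expA sZA sAP sZZP ltCA oP oA.
have p_gt0 := prime_gt0 p_pr; have p_gt1 := prime_gt1 p_pr.
(* By truncation [k + (n - k - i)] is the maximum of [k] and [n - i], so [a i] bounds
   [#|A| + #|P| / p ^ i]; the extra factor [p] absorbs the sum of two terms. *)
pose a i := (#|Z| * p ^ (k + (n - k - i)).+1)%N.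
have mean_le i : (i < k ->
    \sum_(s : i.-tuple gT | indep_in Z A s) #|'C_P([set:: s])| <=
    #|[set s : i.-tuple gT | indep_in Z A s]| * a i)%N.
  move=> lt_ik; rewrite -(@leq_pmul2r (p ^ i)) ?expn_gt0 ?p_gt0 //.
  apply: leq_trans (sum_centraliser_indep p_pr cAA expA sZA i sAP sZZP ltCA) _.
  rewrite -mulnA leq_mul2l; apply/orP; right.
  rewrite oA oP /a -!mulnA -mulnDr leq_mul2l; apply/orP; right.
  rewrite -!expnD; set e := (k + _).+1; have e_gt : (k + i < e + i)%N by lia.
  apply: (@leq_trans (p ^ (e + i).-1 + p ^ (e + i).-1)%N).
    by rewrite leq_add // leq_pexp2l //; rewrite /e; lia.
  by rewrite addnn -muln2 mulnC -[X in (_ <= p ^ X)%N]prednK ?expnS ?leq_mul //; lia.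
have a_gt0 : (0 < \prod_(i < k) a i)%N.
  by rewrite prodn_cond_gt0 // => i _; rewrite muln_gt0 cardG_gt0 expn_gt0 p_gt0.
have := prod_cent_prod_le p_pr cAA expA sZA mean_le.
rewrite -[X in (X <= _)%N]big_set.
move/(sum_inv_ge_of_prod_le a_gt0 (fun (s : k.-tuple gT) _ => cent_prod_gt0 s)).
rewrite big_set; apply: le_trans.
rewrite ler_pdivlMr ?ltr0n // mulrC ler_pdivrMr ?ltr0n ?expn_gt0 ?p_gt0 //.
rewrite -natrM ler_nat (card_indep p_pr cAA) // expn_sum -big_split /=.
apply: leq_prod => j _; rewrite oA -mulnBr -mulnA leq_mul2l; apply/orP; right.
(* The number of choices satisfies [p ^ k - p ^ j >= p ^ k.-1]. This loses a second factor [p],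
   whence the 2 in the exponent. *)
apply: (@leq_trans (p ^ k.-1 * p ^ (2 + (n - k - j)))%N).
  by rewrite -expnD leq_pexp2l //; have := ltn_ord j; lia.
rewrite leq_mul2r; apply/orP; right.
have k_gt0 : (0 < k)%N by case: (k) j => // -[].
apply: leq_trans (leq_sub2l _ (_ : p ^ j <= p ^ k.-1)%N); last first.
  by rewrite leq_pexp2l //; have := ltn_ord j; lia.
have -> : (p ^ k = p * p ^ k.-1)%N by rewrite -expnS prednK.
rewrite -[X in (_ - X)%N]mul1n -mulnBl.
by rewrite leq_pmull // subn_gt0.
Qed.

End CentraliserWeights.

(** * Counting maximal abelian subgroups by their order *)

Section MaximalAbelian.
Local Open Scope group_scope.
Variables (gT : finGroupType) (P : {group gT}) (p n : nat).
Hypotheses (p_pr : prime p) (pP : p.-group P) (expP : exponent P %| p)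
  (oP : #|P| = (#|'Z(P)| * p ^ n)%N).

(** Adjoining to [A] an element that centralises it keeps it abelian, so maximality puts that
    element in [A]. *)
Lemma max_abelian_subgroupsP (A : {group gT}) :
    A \in max_abelian_subgroups P ->
  [/\ A \subset P, abelian A &
      forall v, v \in P -> A \subset 'C[v] -> v \in A].
Proof.
rewrite inE => /maxgroupP[/andP[sAP cAA] maxA]; split=> // v vP cAv.
have <- : A <*> <[v]> = A.
  apply: (maxA (A <*> <[v]>)%G); last exact: joing_subl.
  rewrite join_subG sAP cycle_subG vP /= abelianY cAA cycle_abelian.
  by rewrite cycle_subG -sub_cent1.
by rewrite mem_gen // inE cycle_id orbT.
Qed.

Lemma center_sub_max_abelian (A : {group gT}) :
  A \in max_abelian_subgroups P -> 'Z(P) \subset A.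
Proof.
case/max_abelian_subgroupsP=> sAP _ maxA.
apply/subsetP=> v /setIP[vP cPv]; apply: maxA => //.
by rewrite sub_cent1 (subsetP (centS sAP)).
Qed.

Lemma max_abelian_index (A : {group gT}) :
    A \in max_abelian_subgroups P ->
  exists2 k, k <= n & #|A| = (#|'Z(P)| * p ^ k)%N.
Proof.
move=> mA; have [sAP _ _] := max_abelian_subgroupsP mA.
have sZA := center_sub_max_abelian mA.
have /p_natP[k oAZ] : p.-nat #|A : 'Z(P)|.
  exact: pnat_dvd (dvdn_indexg _ _) (pgroupS sAP pP).
exists k; last by rewrite -oAZ Lagrange.
rewrite -(leq_exp2l _ _ (prime_gt1 p_pr)) -oAZ -(leq_pmul2l (cardG_gt0 'Z(P))).
by rewrite Lagrange // -oP subset_leq_card.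
Qed.

(** A basis together with ['Z(P)] generates its [A], so distinct [A] claim disjoint events, each of
    probability at least [p ^ -e]. *)
Lemma card_max_abelian_of_index (k : nat) :
  #|[set A in max_abelian_subgroups P | #|A| == #|'Z(P)| * p ^ k]%N| <=
    p ^ (\sum_(i < k) (2 + (n - k - i))).
Proof.
set M := [set A in _ | _]; set e := (\sum_(i < k) _)%N.
have p_gt0 := prime_gt0 p_pr.
pose w (s : seq gT) : rat := ((cent_prod P s)%:R^-1)%R.
have w_ge0 s : (0 <= w s)%R by rewrite invr_ge0 ler0n.
have lower A : A \in M ->
    ((p ^ e)%:R^-1 <= \sum_(s : k.-tuple gT | indep_in 'Z(P) A s) w s)%R.
  rewrite inE => /andP[mA /eqP oA].
  have [sAP cAA maxA] := max_abelian_subgroupsP mA.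
  have sZA := center_sub_max_abelian mA.
  apply: sum_inv_cent_prod_ge => //.
    exact: dvdn_trans (exponentS sAP) expP.
  (* By maximality [v] does not centralise [A], so the index of ['C_A[v]] in [A] is a nontrivial
     power of [p]. *)
  move=> v /setDP[vP vNA]; rewrite -(Lagrange (subsetIl A 'C[v])) mulnC leq_mul2l.
  apply/orP; right; have: 1 < #|A : 'C_A[v]|.
    by rewrite indexg_gt1 subsetI subxx; apply: contra vNA; apply: maxA.
  have /p_natP[[|m] ->] // : p.-nat #|A : 'C_A[v]|.
    exact: pnat_dvd (dvdn_indexg _ _) (pgroupS sAP pP).
  by rewrite expnS leq_pmulr // expn_gt0 p_gt0.
have span A (s : k.-tuple gT) :
    A \in M -> indep_in 'Z(P) A s -> 'Z(P) <*> [set:: s] = A.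
  rewrite inE => /andP[mA /eqP oA] fs; have [sAP cAA _] := max_abelian_subgroupsP mA.
  have sZA := center_sub_max_abelian mA; case/andP: (fs) => sA _.
  apply/eqP; rewrite eqEcard sub_joing_indep //= oA.
  rewrite (card_joing_indep p_pr cAA) ?size_tuple //.
  exact: dvdn_trans (exponentS sAP) expP.
have upper : (\sum_(A in M) \sum_(s : k.-tuple gT | indep_in 'Z(P) A s) w s <= 1)%R.
  rewrite (exchange_big_dep (fun s : k.-tuple gT => commuting_in P s)) /=; last first.
    move=> A s; rewrite inE => /andP[/max_abelian_subgroupsP[sAP cAA _] _].
    exact: indep_in_commuting.
  rewrite -[leRHS](sum_inv_cent_prod P k); apply: ler_sum => s _.
  rewrite sumr_const -[leRHS]mulr1n ler_wpMn2l ?w_ge0 //.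
  apply/card_le1_eqP => A B /andP[MA fA] /andP[MB fB].
  by apply/val_inj; rewrite /= -(span _ _ MA fA) -(span _ _ MB fB).
have := le_trans (ler_sum _ lower) upper.
rewrite sumr_const -[(_ *+ _)%R]mulr_natl ler_pdivrMr ?ltr0n ?expn_gt0 ?p_gt0 //.
by rewrite mul1r ler_nat.
Qed.

Lemma card_max_abelian (e : nat) :
    (forall k, k <= n -> \sum_(i < k) (2 + (n - k - i)) <= e)%N ->
  #|max_abelian_subgroups P| <= n.+1 * p ^ e.
Proof.
move=> e_ge.
pose M (k : 'I_n.+1) :=
  [set A in max_abelian_subgroups P | #|A| == #|'Z(P)| * p ^ k]%N.
have /subset_leq_card/leq_trans -> // : max_abelian_subgroups P \subset \bigcup_k M k.
  apply/subsetP => A mA; have [k le_kn oA] := max_abelian_index mA.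
  by apply/bigcupP; exists (inord k) => //; rewrite inE mA oA inordK /=.
apply: leq_trans (_ : \sum_k #|M k| <= _).
  elim/big_ind2: _ => [|A a B b leA leB|k _]; rewrite ?cards0 ?leqnn //.
  by apply: leq_trans (leq_card_setU _ _) _; apply: leq_add.
rewrite -[X in (_ <= X * _)%N](card_ord n.+1) -sum_nat_const.
apply: leq_sum => k _; apply: leq_trans (card_max_abelian_of_index k) _.
by rewrite leq_pexp2l ?prime_gt0 // e_ge // -ltnS.
Qed.

End MaximalAbelian.

(** * The explicit constant and the passage to real exponents *)

Theorem theorem1p15 :
  exists C : R, Rlt 0 C /\
  forall (p : nat) (gT : finGroupType) (P : {group gT}) (n : nat),
    prime p -> odd p ->
    (p.-group P)%g ->
    ([~: P, P] \subset 'Z(P))%g ->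
    (exponent P %| p)%N ->
    #|P / 'Z(P)|%g = (p ^ n)%N ->
    Rle (INR #|max_abelian_subgroups P|)
       (Rpower (INR p) (Rplus (Rdiv (pow (INR n) 2) 6) (Rmult C (INR n)))).
Proof.
(* [7 / 2 = 15 / 6 + 1], where the 1 pays for the [n + 1] possible indices through
   [n + 1 <= p ^ n]. *)
exists (Rdiv 7 2); split; first lra.
move=> p gT P n p_pr _ pP _ expP oPZ.
have oP : #|P| = (#|'Z(P)%g| * p ^ n)%N.
  by rewrite -oPZ card_quotient ?gFnorm // Lagrange ?center_sub.
(* Of [15 * n], [3 * n] comes from [sum_sub_le] and [12 * n] from six times the [2 * k <= 2 * n] of
   the constant summands. *)
pose e := ((n ^ 2 + 15 * n) %/ 6)%N.
have e_ge k : (k <= n -> \sum_(i < k) (2 + (n - k - i)) <= e)%N.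
  move=> le_kn; rewrite leq_divRL // big_split sum_nat_const card_ord /=.
  have := sum_sub_le (n - k) k; rewrite subnK //.
  by move: (bigop.body _ _ _) => S; lia.
have card_le : (#|max_abelian_subgroups P| <= p ^ (n + e))%N.
  apply: leq_trans (card_max_abelian p_pr pP expP oP e_ge) _.
  rewrite expnD leq_mul2r; apply/orP; right; apply: ltn_expl.
  exact: prime_gt1.
have p_gt1 : Rlt 1 (INR p) by have /ssrnat.ltP/lt_INR := prime_gt1 p_pr.
have -> : Rplus (Rdiv (pow (INR n) 2) 6) (Rmult (Rdiv 7 2) (INR n)) =
    Rplus (INR n) (Rdiv (INR (n ^ 2 + 15 * n)) 6).
  rewrite -mulnn plus_INR !mult_INR (INR_IZR_INZ 15) /=.
  by field.
have le_e : Rle (INR e) (Rdiv (INR (n ^ 2 + 15 * n)) 6).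
  have : Rle (INR (e * 6)) (INR (n ^ 2 + 15 * n)).
    by apply: le_INR; apply/ssrnat.leP/leq_divM.
  by rewrite mult_INR (INR_IZR_INZ 6) /=; lra.
apply: Rle_trans (Rle_Rpower _ (INR (n + e)) _ _ _); last first.
- by rewrite plus_INR; lra.
- lra.
rewrite Rpower_pow; last lra.
have <- : INR (p ^ (n + e)) = pow (INR p) (n + e).
  by elim: (n + e) => // m IHm; rewrite expnS mult_INR IHm.
by apply: le_INR; apply/ssrnat.leP.
Qed.
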